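(* For every cubic graph $G$, the line graph $L(G)$ is normal.
   Context: All graphs are finite and simple (no loops or multiple edges). A graph is cubic if every vertex has degree $3$. The line graph $L(G)$ of a graph $G$ has the edges of $G$ as its vertices, two of them being adjacent if and only if the corresponding edges of $G$ share a common vertex. A set $\mathbb{A}$ of subsets of $V(F)$ is a covering of a graph $F$ if every vertex of $F$ is contained in an element of $\mathbb{A}$. A graph $F$ is normal if there exist two coverings $\mathbb{C}$ and $\mathbb{S}$ of $F$ such that each element of $\mathbb{C}$ induces a clique, each element of $\mathbb{S}$ induces a stable (independent) set, and $C\cap S\neq\emptyset$ for every $C\in\mathbb{C}$, $S\in\mathbb{S}$. *)

(* Defs.v *)
From HB Require Import structures.
From mathcomp Require Import all_boot.

Set Implicit Arguments.
Unset Strict Implicit.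
Unset Printing Implicit Defensive.

Record sgraph := SGraph {
  vertex :> finType;
  adj : rel vertex;
  adj_sym : symmetric adj;
  adj_irrefl : irreflexive adj
}.

Definition degree (G : sgraph) (x : G) : nat := #|[set y | adj x y]|.

Definition cubic (G : sgraph) : Prop := forall x : G, degree x = 3.

Definition is_edge (G : sgraph) (E : {set G}) : bool :=
  [exists x, exists y, adj x y && (E == [set x; y])].

Definition edge (G : sgraph) : finType := {E : {set G} | is_edge E}.

Definition line_adj (G : sgraph) : rel (edge G) :=
  fun e f => (e != f) && (val e :&: val f != set0).

Lemma line_adj_sym (G : sgraph) : symmetric (@line_adj G).
Proof. by move=> e f; rewrite /line_adj eq_sym setIC. Qed.

Lemma line_adj_irrefl (G : sgraph) : irreflexive (@line_adj G).
Proof. by move=> e; rewrite /line_adj eqxx. Qed.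

Definition line_graph (G : sgraph) : sgraph :=
  SGraph (@line_adj_sym G) (@line_adj_irrefl G).

Definition clique (F : sgraph) (C : {set F}) : Prop :=
  {in C &, forall x y, x != y -> adj x y}.

Definition stable (F : sgraph) (S : {set F}) : Prop :=
  {in S &, forall x y, ~~ adj x y}.

Definition covering (F : sgraph) (A : {set {set F}}) : Prop :=
  cover A = [set: F].

Definition normal_graph (F : sgraph) : Prop :=
  exists CC SS : {set {set F}},
    [/\ covering CC, covering SS,
        {in CC, forall C, clique C},
        {in SS, forall S, stable S} &
        {in CC & SS, forall C S, C :&: S != set0}].

(* Main.v *)
Require Import Defs.
From mathcomp Require Import all_boot zify.

Set Implicit Arguments.
Unset Strict Implicit.
Unset Printing Implicit Defensive.

(** A clique of the line graph that consists of all edges at a vertex x meets a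
    matching exactly when the matching covers x.  So it is enough to find a
    stable set I of vertices of the cubic graph G such that every edge of G lies
    in a matching that covers all vertices outside I: the cliques are the stars
    of the vertices outside I, which contain every edge because I is stable, and
    the stable sets are the matchings that cover all these vertices.

    If G has no bridge, then I can be empty, since every edge of a bridgeless
    cubic graph lies in a perfect matching.  Bridges are cut: a set X of vertices
    is coverable when a set I of vertices of X, none of them at an edge that
    leaves X, works for all the edges that meet X, those leaving X included.  Two
    coverable sets joined by at most one edge have a coverable union
    (coverable_glue): a matching of one side prescribes only whether the joining
    edge is used, and the other side can comply either way, as each edge at its
    end vertex can be forced into a matching.

    There remain the sets X without two parts joined by at most one edge.
    Counting the edges of odd cuts and using the theorem of Tutte in a version with
    optional vertices shows that I can be empty (mates_through_edge), except when
    exactly one edge leaves X: then X has odd order and a matching that avoids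
    this edge must miss a vertex.  Let c1 and c2 be the other two neighbours of
    the vertex a at which the edge leaves.  If they are not adjacent, replace a
    and its edges by one edge c1 c2; this gives a bridgeless cubic graph.  Its
    perfect matchings without c1 c2 extend by the edge that leaves X, and those
    with c1 c2 turn into matchings that use a c1 or a c2 instead and miss c2 or
    c1.  Hence I = {c1, c2} works (cap_close).  If c1 and c2 are adjacent, the
    triangle a c1 c2 takes over the role of a: it too is left by three edges, and
    matchings of the triangle realise each of them.  Repeating this, one grows a
    ladder (cap_step) that must end at two nonadjacent attachments, because two
    rails ending in the same vertex would create a bridge. *)

(** * Hall's theorem *)

Section Hall.
Variables I J : finType.

Definition nbhd (R : I -> J -> bool) (B : {set I}) : {set J} :=
  [set j | [exists i in B, R i j]].

Lemma nbhdP (R : I -> J -> bool) (B : {set I}) j :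
  reflect (exists2 i, i \in B & R i j) (j \in nbhd R B).
Proof. by rewrite inE; apply: exists_inP. Qed.

(** If some proper nonempty part B of A has no more neighbours than elements, B
    and the rest of A can be treated separately, the rest using elements outside
    nbhd R B only; otherwise every condition has slack, and any first choice
    leaves a family that still satisfies it. *)
Lemma hall (j0 : J) (R : I -> J -> bool) (A : {set I}) :
  (forall B : {set I}, B \subset A -> #|B| <= #|nbhd R B|) ->
  exists2 f : I -> J, {in A &, injective f} & {in A, forall i, R i (f i)}.
Proof.
have [n] := ubnP #|A|; elim: n A R => // n IHn A R; rewrite ltnS => leAn hallA.
have [->|/set0Pn[i iA]] := eqVneq A set0.
  by exists (fun=> j0) => i; rewrite inE.
have [/existsP[B /and4P[B0 sBA neqBA /eqP critB]]|/existsPn slack] :=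
  boolP [exists B : {set I}, [&& B != set0, B \subset A, B != A & #|nbhd R B| == #|B|]].
  have ltBA : #|B| < #|A| by apply: proper_card; rewrite properEneq neqBA.
  have hallB (C : {set I}) : C \subset B -> #|C| <= #|nbhd R C|.
    by move=> sCB; apply: hallA; apply: subset_trans sBA.
  have [f f_inj fR] := IHn B R (leq_trans ltBA leAn) hallB.
  pose R' i j := R i j && (j \notin nbhd R B).
  have ltA'A : #|A :\: B| < n.
    by have := cardsID B A; rewrite (setIidPr sBA); move: B0; rewrite -card_gt0; lia.
  have [C sCA|g g_inj gR] := IHn (A :\: B) R' ltA'A.
    have dCB : [disjoint C & B] by move: sCA; rewrite subsetD => /andP[].
    have sCBA : C :|: B \subset A.
      by rewrite subUset sBA andbT; apply: subset_trans sCA (subsetDl _ _).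
    have := hallA _ sCBA; rewrite cardsU (disjoint_setI0 dCB) cards0 subn0 => hC.
    have sub : nbhd R (C :|: B) \subset nbhd R' C :|: nbhd R B.
      apply/subsetP => j /nbhdP[k kCB Rkj]; rewrite inE.
      have [//|jNB] := boolP (j \in nbhd R B); first by rewrite orbT.
      rewrite orbF; apply/nbhdP; exists k; last by rewrite /R' Rkj.
      move: kCB; rewrite inE => /orP[//|kB]; case/negP: jNB.
      by apply/nbhdP; exists k.
    have := leq_trans hC (subset_leq_card sub).
    by have [+ _] := leq_card_setU (nbhd R' C) (nbhd R B); lia.
  exists (fun i => if i \in B then f i else g i).
    have fNB k : k \in B -> f k \in nbhd R B by move=> kB; apply/nbhdP; exists k => //; apply: fR.
    have gNB k : k \in A -> k \notin B -> g k \notin nbhd R B.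
      by move=> kA kB; have /andP[] := gR k ltac:(by rewrite inE kB).
    move=> k l kA lA; case: ifPn => kB; case: ifPn => lB.
    - exact: f_inj.
    - by move=> E; have := gNB l lA lB; rewrite -E fNB.
    - by move=> E; have := gNB k kA kB; rewrite E fNB.
    - by apply: g_inj; rewrite inE ?kB ?lB.
  move=> k kA; case: ifPn => kB; first exact: fR.
  by have /andP[] := gR k ltac:(by rewrite inE kB).
have slackB (B : {set I}) : B \subset A -> B != set0 -> B != A -> #|B| < #|nbhd R B|.
  move=> sBA B0 neqBA; rewrite ltn_neqAle hallA // andbT eq_sym.
  by have := slack B; rewrite B0 sBA neqBA.
have /card_gt0P[j /nbhdP[_ /set1P-> Rij]] : 0 < #|nbhd R [set i]|.
  by have := hallA [set i]; rewrite sub1set cards1 => ->.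
pose R' k l := R k l && (l != j).
have ltA : #|A :\ i| < n by have := cardsD1 i A; rewrite iA; lia.
have [C sCA|g g_inj gR] := IHn (A :\ i) R' ltA.
  have [->|C0] := eqVneq C set0; first by rewrite cards0.
  have sCA' : C \subset A by apply: subset_trans sCA (subsetDl _ _).
  have CA : C != A.
    by apply: contraTneq sCA => ->; apply/subsetPn; exists i; rewrite // !inE eqxx.
  have := slackB C sCA' C0 CA.
  suff : #|nbhd R C| <= #|nbhd R' C|.+1 by lia.
  rewrite (cardsD1 j) -add1n; apply: leq_add; first by case: (_ \in _).
  apply/subset_leq_card/subsetP => l; rewrite !inE => /andP[lj /exists_inP[k kC Rkl]].
  by apply/exists_inP; exists k; rewrite // /R' Rkl.
exists (fun k => if k == i then j else g k).
  have gj k : k \in A -> k != i -> g k != j.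
    by move=> kA ki; have /andP[] := gR k ltac:(by rewrite !inE ki).
  move=> k l kA lA; case: eqP => [->|/eqP ki]; case: eqP => [->|/eqP li] //.
  - by move=> E; have := gj l lA li; rewrite -E eqxx.
  - by move=> E; have := gj k kA ki; rewrite E eqxx.
  - by apply: g_inj; rewrite !inE ?ki ?li.
move=> k kA; case: eqP => [->//|/eqP ki].
by have /andP[] := gR k ltac:(by rewrite !inE ki).
Qed.

End Hall.

(** * Tutte's theorem *)

Section Tutte.
Variables (T : finType) (r : rel T).
Hypothesis r_sym : symmetric r.

Definition matchable (X : {set T}) : Prop :=
  exists m : T -> T, {in X, forall x, [/\ m x \in X, m (m x) = x & r x (m x)]}.

Lemma matchable0 : matchable set0.
Proof. by exists id => x; rewrite inE. Qed.

Lemma matchable_pair x y : r x y -> matchable [set x; y].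
Proof.
move=> rxy; exists (fun z => if z == x then y else x) => z.
rewrite !inE; have [->|_] /= := eqVneq z x.
  by rewrite eqxx orbT; split=> //; case: eqP.
by move/eqP->; rewrite !eqxx r_sym.
Qed.

Lemma matchableU (X Y : {set T}) :
  [disjoint X & Y] -> matchable X -> matchable Y -> matchable (X :|: Y).
Proof.
move=> dXY [m mP] [m' m'P]; exists (fun x => if x \in X then m x else m' x) => x.
rewrite inE; case: ifP => [xX _|xX /= xY].
  by have [mX mK rm] := mP x xX; rewrite !inE mX.
have [mY mK rm] := m'P x xY.
by rewrite !inE mY orbT (disjointFl dXY mY).
Qed.

Lemma matchable_bigcup (I : finType) (A : {set I}) (B : I -> {set T}) :
  {in A &, forall i j, i != j -> [disjoint B i & B j]} ->
  {in A, forall i, matchable (B i)} -> matchable (\bigcup_(i in A) B i).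
Proof.
have [n] := ubnP #|A|; elim: n A => // n IHn A leAn dis mB.
have [->|/set0Pn[i iA]] := eqVneq A set0; first by rewrite big_set0; apply: matchable0.
rewrite (big_setD1 i iA) /=; apply: matchableU (mB i iA) _; last first.
  apply: IHn => [|j k|j]; first by have := cardsD1 i A; rewrite iA; lia.
    by rewrite !inE => /andP[_ jA] /andP[_ kA]; apply: dis.
  by rewrite inE => /andP[_]; apply: mB.
apply: bigcup_disjoint => j; rewrite !inE => /andP[ji jA].
by apply: dis; rewrite // eq_sym.
Qed.

Lemma disjointDl (A B : {set T}) : [disjoint A :\: B & B].
Proof. by rewrite disjoint_sym disjoints_subset setDE setCI setCK subsetUr. Qed.

Lemma disjointsU1 x (A B : {set T}) :
  [disjoint x |: A & B] = (x \notin B) && [disjoint A & B].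
Proof. by rewrite -!setI_eq0 setIUl setU_eq0 !setI_eq0 disjoints1. Qed.

Lemma odd_cover (F : {set {set T}}) :
  trivIset F -> {in F, forall U : {set T}, odd #|U|} -> odd #|cover F| = odd #|F|.
Proof.
move=> tF oF; rewrite -(eqP tF) -sum1_card; elim/big_rec2: _ => //= U k l UF E.
by rewrite !oddD E oF.
Qed.

(** An obstruction to perfect matchings of X: once S is removed, the members of F
    are odd and have no edges to the rest of X.  They need not be connected, which
    spares all talk of components: a union of components of odd size contains an
    odd component. *)
Definition barrier (X S : {set T}) (F : {set {set T}}) : bool :=
  [&& S \subset X, trivIset F &
   [forall U in F, [&& U \subset X :\: S, odd #|U| &
     [forall u in U, [forall v in X, r u v ==> (v \in U :|: S)]]]]].

Lemma barrierP (X S : {set T}) (F : {set {set T}}) :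
  reflect [/\ S \subset X, trivIset F &
           forall U, U \in F -> [/\ U \subset X :\: S, odd #|U| &
             forall u v, u \in U -> v \in X -> r u v -> v \in U :|: S]]
          (barrier X S F).
Proof.
apply: (iffP and3P) => -[sSX tF FP]; split => //.
  move=> U UF; have /and3P[-> -> /forall_inP clU] := forall_inP FP U UF.
  split=> // u v uU vX; apply/implyP; move: v vX; apply/forall_inP; exact: clU.
apply/forall_inP => U UF; have [-> -> clU] := FP U UF; rewrite /=.
by apply/forall_inP => u uU; apply/forall_inP => v vX; apply/implyP; apply: clU.
Qed.

Lemma trivIsetU (P Q : {set {set T}}) :
  trivIset P -> trivIset Q -> [disjoint cover P & cover Q] -> trivIset (P :|: Q).
Proof.
move=> /trivIsetP tP /trivIsetP tQ dPQ; apply/trivIsetP => A B.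
have dAB C D : C \in P -> D \in Q -> [disjoint C & D].
  by move=> CP DQ; apply: disjointW dPQ; rewrite /cover bigcup_sup.
rewrite !inE => /orP[AP|AQ] /orP[BP|BQ] neqAB.
- exact: tP.
- exact: dAB.
- by rewrite disjoint_sym; apply: dAB.
- exact: tQ.
Qed.

Lemma barrier_cover X S F : barrier X S F -> cover F \subset X :\: S.
Proof. by case/barrierP=> _ _ FP; apply/bigcupsP => U /FP[]. Qed.

(** Barriers compose: a barrier of a part Z that is already separated from the
    rest of X by S can be added to a barrier of X. *)
Lemma barrierU (X S Z S' : {set T}) (F F' : {set {set T}}) :
  barrier X S F -> Z \subset X :\: S -> [disjoint Z & cover F] ->
  (forall z v, z \in Z -> v \in X -> r z v -> v \in Z :|: S) ->
  barrier Z S' F' ->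
  barrier X (S :|: S') (F :|: F') /\ #|F :|: F'| = #|F| + #|F'|.
Proof.
move=> bF sZ dZ clZ bF'.
have sF' := barrier_cover bF'; have /barrierP[sS' tF' F'P] := bF'.
have /barrierP[sSX tF FP] := bF.
have dFF' : [disjoint cover F & cover F'].
  by rewrite disjoint_sym; apply: disjointWl dZ; apply: subset_trans sF' (subsetDl _ _).
split; last first.
  rewrite cardsU [_ :&: _](_ : _ = set0) ?cards0 ?subn0 //.
  apply/setP => U; rewrite !inE; apply/andP => -[UF UF'].
  have [_ oU _] := FP U UF; have [|u uU] := set0Pn U _.
    by apply: contraTneq oU => ->; rewrite cards0.
  have uF : u \in cover F by apply/bigcupP; exists U.
  by have := disjointFr dFF' uF; rewrite (_ : u \in _) //; apply/bigcupP; exists U.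
apply/barrierP; split; first 1 [|exact: trivIsetU].
  rewrite subUset sSX; apply: subset_trans sS' (subset_trans sZ _); exact: subsetDl.
move=> U; rewrite inE => /orP[UF|UF'].
  have [sU oU clU] := FP U UF; split => //.
    apply/subsetP => u uU; have := subsetP sU u uU; rewrite !inE => /andP[/negPf-> ->].
    rewrite andbT /=; apply/negP => uS'.
    have := disjointFr dZ (subsetP sS' u uS').
    by rewrite (_ : u \in _) //; apply/bigcupP; exists U.
  by move=> u v uU vX ruv; have := clU u v uU vX ruv; rewrite !inE => /orP[]->; rewrite ?orbT.
have [sU oU clU] := F'P U UF'; split => //.
  apply/subsetP => u uU; have := subsetP sU u uU; rewrite !inE negb_or => /andP[-> uZ].
  by have := subsetP sZ u uZ; rewrite !inE andbT.
move=> u v uU vX ruv; have uZ : u \in Z by have := subsetP sU u uU; rewrite inE => /andP[].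
have := clZ u v uZ vX ruv; rewrite !inE => /orP[vZ|->]; last by rewrite orbT.
by have := clU u v uU vZ ruv; rewrite !inE => /orP[]->; rewrite ?orbT.
Qed.

Section Leftover.
Variables (X S : {set T}) (F : {set {set T}}).
Hypothesis bF : barrier X S F.
Let W := X :\: S :\: cover F.

Lemma leftover_closed u v : u \in W -> v \in X -> r u v -> v \in W :|: S.
Proof.
have /barrierP[_ _ FP] := bF.
rewrite 2!in_setD => /and3P[uF uS uX] vX ruv; rewrite in_setU 2!in_setD vX.
have [//|vS] := boolP (v \in S); first by rewrite orbT.
rewrite orbF !andbT; apply: contra uF => /bigcupP[U UF vU].
have [_ _ clU] := FP U UF; have := clU v u vU uX; rewrite r_sym => /(_ ruv).
by rewrite inE (negPf uS) orbF => uU; apply/bigcupP; exists U.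
Qed.

(** Parity of the part of X that a barrier leaves out: this is why, for even X, a
    barrier cannot fall short of Tutte's condition by one only. *)
Lemma odd_leftover : odd #|W| = odd #|X| (+) (odd #|S| (+) odd #|F|).
Proof.
have /barrierP[sSX tF FP] := bF.
rewrite -(odd_cover tF) => [|U /FP[]//].
have := cardsID S X; rewrite (setIidPr sSX) => <-.
have := cardsID (cover F) (X :\: S); rewrite (setIidPr (barrier_cover bF)) => <-.
by rewrite !oddD -/W; case: (odd #|S|); case: (odd #|cover F|); case: (odd #|W|).
Qed.

Lemma barrier_add_leftover : odd #|W| -> barrier X S (W |: F) /\ #|W |: F| = #|F|.+1.
Proof.
move=> oW; have bW : barrier W set0 [set W].
  apply/barrierP; split; first exact: sub0set.
    by apply/trivIsetP => A B /set1P-> /set1P->; rewrite eqxx.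
  by move=> U /set1P->; split; rewrite ?setD0 // => u v _ vW _; rewrite inE vW.
have := barrierU bF (subsetDl _ _) _ leftover_closed bW.
rewrite setU0 cards1 addn1 setUC; apply.
exact: disjointDl.
Qed.

End Leftover.

Lemma barrier_le (X : {set T}) : ~~ odd #|X| ->
  (forall S F, barrier X S F -> #|F| <= #|S|.+1) ->
  forall S F, barrier X S F -> #|F| <= #|S|.
Proof.
move=> eX leF S F bF; have := leF S F bF; rewrite leq_eqVlt => /orP[/eqP E|//].
have [|bF' cF'] := barrier_add_leftover bF.
  by rewrite odd_leftover // (negPf eX) E /= addbN addbb.
by have := leF _ _ bF'; rewrite cF' E ltnn.
Qed.

(** Take a barrier (S, F) with #|F| = #|S| and S as large as possible.  By
    induction the leftover W has a perfect matching.  So has U minus g for each U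
    in F and g in U, since a violating barrier of it would extend S to a larger
    tight barrier.  Tutte's condition for the subsets of F is the condition of
    Hall's theorem for matching each U to an element of S.  The hypothesis allows
    one set too many because parity excludes this case. *)
Lemma tutte (X : {set T}) : ~~ odd #|X| ->
  (forall S F, barrier X S F -> #|F| <= #|S|.+1) -> matchable X.
Proof.
have [n] := ubnP #|X|; elim: n X => // n IHn X ltXn eX leF1.
have leF := barrier_le eX leF1.
have [->|/set0Pn[x xX]] := eqVneq X set0; first exact: matchable0.
(* the barrier ([set x], X minus x) ensures that S is not empty *)
pose tight (p : {set T} * {set {set T}}) := barrier X p.1 p.2 && (#|p.1| == #|p.2|).
have tight0 : tight ([set x], [set X :\ x]).
  rewrite /tight !cards1 eqxx andbT /=; apply/barrierP; split; first by rewrite sub1set.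
    by apply/trivIsetP => A B /set1P-> /set1P->; rewrite eqxx.
  move=> U /set1P->; split => //; first by move: eX; rewrite (cardsD1 x) xX negbK.
  by move=> u v _ vX _; rewrite !inE vX andbT orNb.
case: (arg_maxnP (fun p : {set T} * {set {set T}} => #|p.1|) tight0) => -[S F] /andP[/= bF /eqP cSF] maxS.
have S_gt0 : 0 < #|S| by have := maxS _ tight0; rewrite /= cards1.
have /barrierP[sSX tF FP] := bF.
pose W := X :\: S :\: cover F.
have dWF : [disjoint W & cover F].
  exact: disjointDl.
have cW : #|W| < #|X|.
  have := cardsID S X; rewrite (setIidPr sSX); have := subset_leq_card (subsetDl (X :\: S) (cover F)).
  by rewrite -/W; lia.
have mW : matchable W.
  apply: IHn; first by lia.
    by rewrite odd_leftover // cSF addbb addbF.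
  move=> S' F' bF'; have [b c] := barrierU bF (subsetDl _ _) dWF (leftover_closed bF) bF'.
  have := leF _ _ b; rewrite c => le1; have [le2 _] := leq_card_setU S S'.
  by apply: leqW; rewrite -(leq_add2l #|F|) -{2}cSF; apply: leq_trans le1 le2.
have mU U g : U \in F -> g \in U -> matchable (U :\ g).
  move=> UF gU; have [sU oU clU] := FP U UF.
  have sUX : #|U| <= #|X| by apply/subset_leq_card/(subset_trans sU)/subsetDl.
  have gXS := subsetP sU g gU; have := gXS; rewrite inE => /andP[gS gX].
  have cU : #|U| = #|U :\ g|.+1 by rewrite (cardsD1 g) gU.
  apply: IHn; [by rewrite -cU (leq_trans sUX)|by move: oU; rewrite cU|].
  move=> S' F' bF'; rewrite leqNgt; apply/negP => ltF'.
  have bFU : barrier X (g |: S) (F :\ U).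
    apply/barrierP; split; first by rewrite subUset sub1set gX.
      by apply: trivIsetS tF; apply: subsetDl.
    move=> V; rewrite !inE => /andP[VU VF]; have [sV oV clV] := FP V VF; split => //.
      apply/subsetP => v vV; have := subsetP sV v vV; rewrite !inE => /andP[vS ->].
      rewrite andbT negb_or vS andbT; apply: contraNneq VU => vg.
      apply/eqP; apply: contraTeq vV => VU; rewrite vg.
      by have := trivIsetP tF _ _ VF UF VU => d; rewrite (disjointFl d gU).
    by move=> u v uV vX ruv; have := clV u v uV vX ruv; rewrite !inE => /orP[]->; rewrite ?orbT.
  have [||| b c] := barrierU bFU _ _ _ bF'.
  - apply/subsetP => v; rewrite !inE negb_or => /andP[-> vU] /=.
    by have := subsetP sU v vU; rewrite inE.
  - apply/bigcup_disjoint => V; rewrite !inE => /andP[VU VF].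
    by apply: disjointWl (subsetDl _ _) _; apply: (trivIsetP tF) => //; rewrite eq_sym.
  - move=> z v; rewrite !inE => /andP[zg zU] vX rzv; have := clU z v zU vX rzv.
    by rewrite !inE => /orP[]->; rewrite ?orbT //; case: eqP.
  have := leF _ _ b; rewrite c => le1; have := cardsD1 U F; rewrite UF => cF.
  have [le2 _] := leq_card_setU (g |: S) S'.
  move: le2; rewrite cardsU1 gS => le2.
  have arith (a f f' s s' s'' : nat) : s = f -> f = true + a -> s'.+1 < f' ->
    a + f' <= s'' -> s'' <= true + s + s' -> s'' = a + f' /\ s < s'' by clear; lia.
  have [e lt] := arith _ _ _ _ _ _ cSF cF ltF' le1 le2.
  have := maxS (g |: S :|: S', F :\ U :|: F'); rewrite /tight /= b c e eqxx => /(_ isT).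
  by rewrite /= -e leqNgt lt.
have [x0 x0S] : exists s, s \in S by apply/set0Pn; rewrite -card_gt0.
pose R (U : {set T}) s := (s \in S) && [exists u in U, r u s].
have hallF (B : {set {set T}}) : B \subset F -> #|B| <= #|nbhd R B|.
  move=> sBF; apply: leF; have sNS : nbhd R B \subset S.
    by apply/subsetP => s /nbhdP[U _ /andP[]].
  apply/barrierP; split; first exact: subset_trans sSX.
    exact: trivIsetS tF.
  move=> U UB; have [sU oU clU] := FP U (subsetP sBF U UB); split => //.
    by apply: subset_trans sU _; apply: setDS.
  move=> u v uU vX ruv; have := clU u v uU vX ruv; rewrite !inE => /orP[->//|vS].
  apply/orP; right; apply/exists_inP; exists U => //; rewrite /R vS.
  by apply/exists_inP; exists u.
have [f f_inj fR] := hall x0 hallF.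
have fS U : U \in F -> f U \in S by move=> /fR/andP[].
have imf : f @: F = S.
  apply/eqP; rewrite eqEcard card_in_imset // cSF leqnn andbT.
  by apply/subsetP => _ /imsetP[U UF ->]; apply: fS.
have UNS U s : U \in F -> s \in S -> s \notin U.
  by move=> UF sS; have [sU _ _] := FP U UF; apply/negP => /(subsetP sU); rewrite inE sS.
have -> : X = W :|: \bigcup_(U in F) (f U |: U).
  apply/setP => y; rewrite !inE; apply/idP/idP => [yX|].
    rewrite yX andbT; have [yS|yS] := boolP (y \in S).
      move: yS; rewrite -imf => /imsetP[U UF ->]; apply/orP; right.
      by apply/bigcupP; exists U; rewrite // !inE eqxx.
    have [/bigcupP[U UF yU]|//] := boolP (y \in cover F).
    by apply/orP; right; apply/bigcupP; exists U; rewrite // !inE yU orbT.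
  case/orP => [/and3P[]//|/bigcupP[U UF]]; rewrite !inE => /orP[/eqP->|yU].
    exact: (subsetP sSX) (fS _ UF).
  by have [sU _ _] := FP U UF; have := subsetP sU y yU; rewrite inE => /andP[].
apply: matchableU mW _.
  apply/bigcup_disjoint => U UF; rewrite disjoint_sym disjointsU1 !inE (fS _ UF) /= andbF /=.
  by rewrite disjoint_sym; apply: disjointWr dWF; apply: bigcup_sup.
apply: matchable_bigcup => [U V UF VF UV|U UF].
  rewrite disjointsU1 !inE negb_or (UNS V) ?fS // andbT disjoint_sym disjointsU1 (UNS U) ?fS //=.
  have VU : V != U by rewrite eq_sym.
  rewrite (trivIsetP tF _ _ VF UF VU) andbT.
  by apply: contra_neq UV => E; apply: f_inj.
have /andP[_ /exists_inP[g gU rg]] := fR U UF.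
have -> : f U |: U = (U :\ g) :|: [set g; f U].
  by apply/setP => y; rewrite !inE; case: (eqVneq y g) => [->|]; rewrite ?gU ?orbT //= orbC.
apply: matchableU (mU _ _ UF gU) (matchable_pair rg).
rewrite disjoint_sym disjointsU1 !inE eqxx /= disjoints1 !inE.
by rewrite (negPf (UNS U _ UF (fS _ UF))) andbF.
Qed.

(** Turning the optional vertices into a clique lets unmatched ones pair up. *)
Definition with_clique (X D : {set T}) : rel T := fun a b =>
  [&& r a b, a \in X & b \in X] || (a \in D) && (b \in D).

End Tutte.

Lemma with_clique_sym (T : finType) (r : rel T) (X D : {set T}) :
  symmetric r -> symmetric (with_clique r X D).
Proof. by move=> r_sym a b; rewrite /with_clique r_sym [(b \in X) && _]andbC [(b \in D) && _]andbC. Qed.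

(** Matchings of X that may leave vertices of D uncovered are perfect matchings of
    the graph in which D is made a clique, joined by an extra vertex z of this
    clique when X is odd.  At most one member of a barrier can meet the clique, so
    parity makes up for the one set by which the condition may fail. *)
Lemma tutte_optional (T : finType) (r : rel T) (X D : {set T}) (z : T) :
  symmetric r -> z \notin X ->
  (forall S F, barrier r X S F -> [disjoint D & cover F] -> #|F| <= #|S|) ->
  exists m : T -> T, {in X, forall x, m x = x /\ x \in D \/
                       [/\ m x \in X, m (m x) = x & r x (m x)]}.
Proof.
move=> r_sym zX leF; pose E := z |: D.
pose X' := if odd #|X| then z |: X else X.
have sXX' : X \subset X' by rewrite /X'; case: ifP => // _; apply: subsetUr.
have sX' x : x \in X' -> x != z -> x \in X.
  by rewrite /X'; case: ifP => // _; rewrite !inE => /orP[->|->].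
have [||m mP] := @tutte T _ (with_clique_sym X E r_sym) X'.
- by rewrite /X'; case: ifP => [oX|->//]; rewrite cardsU1 zX /= oX.
- move=> S F /barrierP[sSX' tF FP]; pose F0 := [set U in F | [disjoint E & U]].
  have leF0 : #|F0| <= #|S|.
    apply: leq_trans (leF (S :&: X) F0 _ _) (subset_leq_card (subsetIl _ _)).
      apply/barrierP; split; first exact: subsetIr.
        by apply: trivIsetS tF; apply/subsetP => U; rewrite inE => /andP[].
      move=> U; rewrite inE => /andP[UF dU]; have [sU oU clU] := FP U UF; split => //.
        apply/subsetP => u uU; have := subsetP sU u uU.
        rewrite !inE => /andP[/negPf-> uX'] /=; apply: sX' => //.
        by apply: contraTneq uU => ->; rewrite (disjointFr dU) // !inE eqxx.
      move=> u v uU vX ruv; have uX : u \in X.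
        apply: sX'; first by have := subsetP sU u uU; rewrite inE => /andP[].
        by apply: contraTneq uU => ->; rewrite (disjointFr dU) // !inE eqxx.
      have := clU u v uU (subsetP sXX' v vX); rewrite /with_clique ruv uX vX => /(_ isT).
      by rewrite !inE vX andbT.
    apply/bigcup_disjoint => U; rewrite inE => /andP[_]; apply: disjointWl.
    exact: subsetUr.
  rewrite -(cardsID F0 F) -addn1; apply: leq_add.
    by apply: leq_trans leF0; apply/subset_leq_card/subsetIr.
  apply/card_le1_eqP => A B; rewrite !inE !negb_and.
  have [/= AF|//] := boolP (A \in F); have [/= BF|] := boolP (B \in F); last by rewrite andbF.
  rewrite !andbT => /pred0Pn[a /andP[/= aE aA]] /pred0Pn[b /andP[/= bE bB]].
  have [sA _ clA] := FP A AF; have [sB _ _] := FP B BF.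
  have := subsetP sB b bB; rewrite inE => /andP[bS bX'].
  have := clA a b aA bX'; rewrite /with_clique aE bE orbT inE (negPf bS) orbF => /(_ isT) bA.
  by apply: contraTeq bB => AB; have d := trivIsetP tF _ _ BF AF AB; rewrite (disjointFl d bA).
exists (fun x => if r x (m x) && (m x \in X) then m x else x) => x xX.
have [mX' mK rm] := mP x (subsetP sXX' x xX).
have [/andP[rxm mX]|nrm] := ifPn; first by right; rewrite mK r_sym rxm xX.
left; split => //; move: rm; rewrite /with_clique xX /= (negPf nrm) !inE.
by case/andP => /orP[/eqP xz|//]; rewrite -xz xX in zX.
Qed.

(** * Counting edges between sets *)

Section EdgeCount.
Variables (T : finType) (r : rel T).
Hypotheses (r_sym : symmetric r) (r_irr : irreflexive r).
Implicit Types A B C : {set T}.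

Definition ecount A B : nat := \sum_(x in A) \sum_(y in B) r x y.

Lemma ecountC A B : ecount A B = ecount B A.
Proof.
rewrite /ecount exchange_big; apply: eq_bigr => y _.
by apply: eq_bigr => x _; rewrite r_sym.
Qed.

Lemma ecountIDr A B C : ecount A B = ecount A (B :&: C) + ecount A (B :\: C).
Proof. by rewrite /ecount -big_split; apply: eq_bigr => x _; rewrite (big_setID C). Qed.

Lemma ecountIDl A B C : ecount A B = ecount (A :&: C) B + ecount (A :\: C) B.
Proof. by rewrite ![ecount _ B]ecountC -ecountIDr. Qed.

Lemma ecountSr A B C : B \subset C -> ecount A B <= ecount A C.
Proof. by move=> sBC; rewrite (ecountIDr A C B) (setIidPr sBC) leq_addr. Qed.

Lemma ecountUr A B C : [disjoint B & C] -> ecount A (B :|: C) = ecount A B + ecount A C.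
Proof.
move=> dBC; rewrite (ecountIDr A _ B) setUK setDUl setDv set0U.
by congr (_ + ecount A _); apply/setDidPl; rewrite disjoint_sym.
Qed.

Lemma ecountS A A' B B' : A \subset A' -> B \subset B' -> ecount A B <= ecount A' B'.
Proof.
move=> sA sB; apply: leq_trans (ecountSr A sB) _.
by rewrite ecountC [leqRHS]ecountC ecountSr.
Qed.

Lemma ecount_gt0 A B x y : x \in A -> y \in B -> r x y -> 0 < ecount A B.
Proof. by move=> xA yB rxy; rewrite /ecount (bigD1 x) //= (bigD1 y) //= rxy. Qed.

Lemma ecount0 A B : {in A & B, forall x y, ~~ r x y} -> ecount A B = 0.
Proof.
by move=> nr; rewrite /ecount big1 // => x xA; rewrite big1 // => y yB; rewrite (negPf (nr x y xA yB)).
Qed.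

Lemma ecount_card A B :
  ecount A B = #|[set p : T * T | [&& p.1 \in A, p.2 \in B & r p.1 p.2]]|.
Proof.
rewrite /ecount pair_big_dep -sum1dep_card [RHS]big_mkcond [LHS]big_mkcond /=.
by apply: eq_bigr => -[x y] _ /=; case: (x \in A); case: (y \in B); case: (r x y).
Qed.

Lemma ecount_le1P A B :
  reflect (forall x x' y y', x \in A -> x' \in A -> y \in B -> y' \in B ->
             r x y -> r x' y' -> x = x' /\ y = y') (ecount A B <= 1).
Proof.
rewrite ecount_card; apply: (iffP card_le1_eqP) => [eqAB x x' y y' xA x'A yB y'B rxy rxy'|eqAB].
  have := eqAB (x, y) (x', y'); rewrite !inE /= xA yB x'A y'B rxy rxy' => /(_ isT isT).
  by case.
move=> [x y] [x' y']; rewrite !inE /= => /and3P[xA yB rxy] /and3P[x'A y'B rxy'].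
by have [-> ->] := eqAB _ _ _ _ xA x'A yB y'B rxy rxy'.
Qed.

Lemma ecount_setT d A : {in A, forall x, #|[set y | r x y]| = d} -> ecount A setT = d * #|A|.
Proof.
move=> rd; rewrite /ecount mulnC -sum_nat_const; apply: eq_bigr => x /rd <-.
by rewrite -sum1_card big_mkcond [RHS]big_mkcond; apply: eq_bigr => y _; rewrite !inE; case: (r x y).
Qed.

Lemma even_ecount A : ~~ odd (ecount A A).
Proof.
have [n] := ubnP #|A|; elim: n A => // n IHn A leAn.
have [->|/set0Pn[x xA]] := eqVneq A set0; first by rewrite /ecount big_set0.
have IH := IHn (A :\ x).
rewrite (ecountIDr A A [set x]) (setIidPr _) ?sub1set //.
rewrite (ecountIDl A _ [set x]) (ecountIDl A (A :\ x) [set x]) (setIidPr _) ?sub1set //.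
have -> : ecount [set x] [set x] = 0 by apply: ecount0 => _ _ /set1P-> /set1P->; rewrite r_irr.
rewrite add0n addnA (ecountC (A :\ x)) addnn oddD odd_double.
by apply: IH; move: leAn; rewrite (cardsD1 x) xA.
Qed.

Lemma ecount_cover (F : {set {set T}}) B :
  trivIset F -> ecount (cover F) B = \sum_(U in F) ecount U B.
Proof. exact: big_trivIset. Qed.

End EdgeCount.

(** * Matchings in cubic graphs without small cuts *)

(** A matching of the edges that meet X: m x is the partner of x, possibly
    outside X, and the fixed points of m, allowed in I only, are uncovered. *)
Definition mates (T : finType) (r : rel T) (X I : {set T}) (m : T -> T) : Prop :=
  {in X, forall x, [/\ m x \in X -> m (m x) = x & r x (m x) || (x \in I) && (m x == x)]}.

Section TwoEdgeConnected.
Variables (T : finType) (r : rel T) (X : {set T}).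
Hypotheses (r_sym : symmetric r) (r_irr : irreflexive r).
Hypothesis r_cubic : {in X, forall x, #|[set y | r x y]| = 3}.
Hypothesis no_bridge : forall Y : {set T},
  Y \subset X -> Y != set0 -> Y != X -> 1 < ecount r Y (X :\: Y).
Hypothesis no_single_exit : ecount r X (~: X) != 1.

Lemma ecount_cubic (A : {set T}) : A \subset X -> ecount r A setT = 3 * #|A|.
Proof. by move=> sAX; apply: ecount_setT => x xA; apply/r_cubic/(subsetP sAX). Qed.

(** The degree sum 3 * #|U| is odd, so the number of edges leaving U is odd;
    since it is not 1, it is at least 3. *)
Lemma odd_cut (U : {set T}) : U \subset X -> odd #|U| -> 2 < ecount r U (~: U).
Proof.
move=> sUX oU; have cU := ecount_cubic sUX.
have U0 : U != set0 by apply: contraTneq oU => ->; rewrite cards0.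
have o : odd (ecount r U (~: U)).
  have : odd (ecount r U setT) by rewrite cU oddM oU.
  by rewrite (ecountIDr _ _ _ U) setTI setTD oddD (negPf (even_ecount r_sym r_irr U)).
have [UX|UX] := eqVneq U X.
  by move: o no_single_exit; rewrite -UX; case: (ecount _ _ _) => [|[|[|]]].
have : 1 < ecount r U (~: U).
  apply: leq_trans (no_bridge sUX U0 UX) _; apply: ecountSr.
  by rewrite setDE subsetIr.
by move: o; case: (ecount _ _ _) => [|[|[|]]].
Qed.

Lemma odd_family_count (S : {set T}) (F : {set {set T}}) :
  S \subset X -> trivIset F ->
  {in F, forall U : {set T}, [/\ U \subset X, odd #|U| &
     forall u v, u \in U -> r u v -> v \in U :|: S]} ->
  3 * #|F| + ecount r S (~: cover F) <= 3 * #|S|.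
Proof.
move=> sSX tF FP; rewrite -ecount_cubic // (ecountIDr _ S setT (cover F)) setTI setTD.
rewrite leq_add2r ecountC // ecount_cover // mulnC -sum_nat_const.
apply: leq_sum => U UF; have [sU oU clU] := FP U UF.
apply: leq_trans (odd_cut sU oU) _.
rewrite (ecountIDr _ _ _ S) [X in _ + X]ecount0 ?addn0; first by apply/ecountSr/subsetIr.
move=> u v uU; rewrite !inE => /andP[vS vU]; apply/negP => /(clU u v uU).
by rewrite inE (negPf vU) (negPf vS).
Qed.

(** The members of F send at least 3 edges each into S' = S + x + y, whose degree
    sum is 3 * #|S'|.  If y is outside X, the edge x y alone spoils the excess.
    Otherwise, an excess would leave at most 3 edge ends at S' for the edges not
    going to F; two are taken by the edge x y.  The last one cannot join S' to the
    leftover W, which is reached by at least two edges; and if W is empty, X is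
    odd, hence left by at least three edges, all of them starting in S'. *)
Lemma barrier_count (x y : T) (S : {set T}) (F : {set {set T}}) :
  x \in X -> r x y -> barrier r (X :\: [set x; y]) S F ->
  (forall u v, u \in cover F -> r u v -> v \in X) -> #|F| <= #|S|.
Proof.
move=> xX rxy bF exitF; have /barrierP[sS tF FP] := bF.
have xy : x != y by apply: contraTneq rxy => ->; rewrite r_irr.
pose E := X :&: [set x; y]; pose S' := S :|: E.
have sSX : S \subset X by apply: subset_trans sS (subsetDl _ _).
have sS'X : S' \subset X by rewrite subUset sSX subsetIl.
have FP' : {in F, forall U : {set T}, [/\ U \subset X, odd #|U| &
     forall u v, u \in U -> r u v -> v \in U :|: S']}.
  move=> U UF; have [sU oU clU] := FP U UF; split=> // [|u v uU ruv].
    apply: subset_trans sU (subset_trans (subsetDl _ _) (subsetDl _ _)).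
  have vX : v \in X by apply: exitF ruv; apply/bigcupP; exists U.
  have [vE|vE] := boolP (v \in [set x; y]); first by rewrite !in_setU in_setI vX vE !orbT.
  have := clU u v uU; rewrite in_setD vX vE => /(_ isT ruv).
  by rewrite /S' setUA [v \in (_ :|: E)]inE => ->.
have count := odd_family_count sS'X tF FP'.
have xE : x \in E by rewrite !inE xX eqxx.
have xS' : x \in S' by rewrite in_setU xE orbT.
have sF := barrier_cover bF.
have dF v : v \in cover F -> [&& v \in X, v \notin S, v != x & v != y].
  by move/(subsetP sF); rewrite !inE negb_or => /and3P[-> /andP[-> ->] ->].
have cS' : #|S'| = #|S| + #|E|.
  rewrite cardsU [S :&: E](_ : _ = set0) ?cards0 ?subn0 //.
  apply/setP => v; rewrite !inE; apply/and3P => -[vS _ vE].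
  by have := subsetP sS v vS; rewrite !inE vE.
have yF : y \in ~: cover F by rewrite inE; apply/negP => /dF; rewrite eqxx !andbF.
have xF : x \in ~: cover F by rewrite inE; apply/negP => /dF; rewrite eqxx !andbF.
have gt0 := ecount_gt0 xS' yF rxy.
have [yX|yX] := boolP (y \in X); last first.
  have cE : #|E| = 1.
    rewrite /E (_ : _ :&: _ = [set x]) ?cards1 //; apply/setP => v; rewrite !inE.
    have [->|_] := eqVneq v x; first by rewrite xX.
    by case: eqP => [->|_] /=; rewrite ?(negPf yX) ?andbF.
  move: count gt0; rewrite cS' cE; clear; move: (ecount _ _ _) #|F| #|S|; lia.
have EE : E = [set x; y].
  by apply/setIidPr; rewrite subUset !sub1set xX yX.
have cE : #|E| = 2 by rewrite EE cards2 xy.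
have yE : y \in E by rewrite EE !inE eqxx orbT.
have count2 : 1 < ecount r S' E.
  rewrite ltnNge; apply/negP => /ecount_le1P /(_ x y y x).
  rewrite !in_setU xE yE !orbT rxy r_sym rxy => /(_ isT isT isT isT isT isT) [exy _].
  by rewrite exy eqxx in xy.
rewrite leqNgt; apply/negP => ltSF.
have sEF : E \subset ~: cover F by rewrite EE subUset !sub1set xF yF.
have eqFS : #|F| = #|S|.+1.
  move: count count2 ltSF (ecountSr r S' sEF); rewrite cS' cE; clear.
  move: (ecount _ _ (~: _)) (ecount _ _ E) #|F| #|S|; lia.
(* beyond the two ends of x y, at most one edge end at S' is left *)
have small (B : {set T}) : B \subset ~: cover F -> [disjoint E & B] -> ecount r S' B <= 1.
  move=> sB dB; have sEB : E :|: B \subset ~: cover F.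
    by rewrite subUset sEF.
  have := ecountSr r S' sEB; rewrite ecountUr // => le.
  move: count le count2; rewrite eqFS cS' cE; clear.
  move: (ecount _ _ (~: _)) (ecount _ _ E) (ecount _ _ B) #|S|; lia.
pose W := X :\: S' :\: cover F.
have dEB (B : {set T}) : [disjoint S' & B] -> [disjoint E & B].
  by apply: disjointWl; apply: subsetUr.
have [W0|W0] := eqVneq W set0; last first.
  have sWX : W \subset X by rewrite /W setDDl subsetDl.
  have WX : W != X by apply: contraTneq xX => <-; rewrite in_setD in_setD xS' andbF.
  have cutW := no_bridge sWX W0 WX.
  have : ecount r S' W <= 1.
    apply: small; first by rewrite /W setDE subsetIr.
    apply: dEB; rewrite disjoint_sym.
    exact: disjointWl (subsetDl _ _) (disjointDl _ _).
  rewrite leqNgt => /negP; apply; apply: leq_trans cutW _; rewrite ecountC //.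
  rewrite (ecountIDl r_sym _ _ S') [X in _ + X]ecount0 ?addn0.
    by apply: ecountS => //; apply: subsetIr.
  move=> u v; rewrite 2!in_setD => /and3P[uS' uW uX] vW.
  have uF : u \in cover F by move: uW; rewrite in_setD in_setD uX uS' !andbT negbK.
  apply/negP => ruv; case/bigcupP: uF => U UF uU; have [_ _ clU] := FP' U UF.
  have := clU u v uU ruv; move: vW; rewrite in_setD in_setD => /and3P[vF vS' _].
  rewrite in_setU (negPf vS') orbF => vU.
  by case/negP: vF; apply/bigcupP; exists U.
have oX : odd #|X|.
  have := cardsID S' X; rewrite (setIidPr sS'X).
  have := cardsID (cover F) (X :\: S'); rewrite -/W W0 cards0 addn0.
  rewrite (setIidPr _) => [<-|]; last first.
    apply/subsetP => v vF; have /and4P[vX vS vx vy] := dF v vF.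
    by rewrite in_setD vX andbT in_setU negb_or vS EE !inE negb_or vx vy.
  move=> <-; rewrite oddD (odd_cover tF) => [|U /FP[]//].
  rewrite eqFS.
  by rewrite cS' cE oddD /= addbF addbN addbb.
have := odd_cut (subxx X) oX; rewrite ltnNge => /negP; apply; apply: leqW.
have outE : [disjoint E & ~: X] by rewrite disjoints_subset setCK subsetIl.
apply: leq_trans (small _ _ outE); last first.
  by rewrite setCS; apply/subsetP => v /dF/and4P[].
rewrite (ecountIDl r_sym _ _ S') [X in _ + X]ecount0 ?addn0.
  by apply: ecountS => //; apply: subsetIr.
move=> u v; rewrite in_setD in_setC => /andP[uS' uX] vX.
have uF : u \in cover F.
  by have /setP/(_ u) := W0; rewrite in_set0 in_setD in_setD uX uS' !andbT => /negbFE.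
by apply: contra vX => /(exitF u v uF).
Qed.

(** This contains the theorem of Schoenberger that every edge of a bridgeless
    cubic graph lies in a perfect matching.  The vertices with an edge leaving X
    are optional: when uncovered inside, they are matched to the outside. *)
Lemma mates_through_edge (x y : T) : x \in X -> r x y ->
  exists2 m, mates r X set0 m & m x = y.
Proof.
move=> xX rxy; pose X0 := X :\: [set x; y].
have xy : x != y by apply: contraTneq rxy => ->; rewrite r_irr.
pose out w := odflt w [pick v | r w v && (v \notin X)].
pose D := [set w in X0 | out w \notin X].
have outP w : w \in X -> out w \notin X -> r w (out w).
  by rewrite /out; case: pickP => [v /andP[]//|_ /= ->].
(* x itself serves as the extra vertex, as it is not in X0 *)
have [||m mP] := @tutte_optional T r X0 D x r_sym.
- by rewrite !inE eqxx.
- move=> S F bF dDF; have sF := subset_trans (barrier_cover bF) (subsetDl _ _).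
  apply: barrier_count xX rxy bF _ => u v uF ruv.
  have := disjointFl dDF uF; rewrite inE (subsetP sF u uF) /=.
  move/negbFE; rewrite /out; case: pickP => [w /andP[_ /negPf->]//|/(_ v)].
  by rewrite ruv /= => /negbFE.
exists (fun w => if w == x then y else if w == y then x else
                 if m w == w then out w else m w); last by rewrite eqxx.
move=> w wX; rewrite inE /= orbF.
have [->|wx] := eqVneq w x; first by rewrite eqxx (negPf (_ : y != x)) // eq_sym.
have [->|wy] := eqVneq w y; first by rewrite eqxx r_sym.
have wX0 : w \in X0 by rewrite !inE negb_or wx wy.
have [mw|mw] := eqVneq (m w) w.
  have [[_]|[_ _]] := mP w wX0; last by rewrite mw r_irr.
  by rewrite inE => /andP[_ /[dup] outw /(outP w wX) ->]; rewrite (negPf outw).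
have [[/eqP]|[mX0 mK rm]] := mP w wX0; first by rewrite (negPf mw).
rewrite rm mK; move: mX0; rewrite !inE negb_or => /andP[/andP[/negPf-> /negPf->] _].
by rewrite eq_sym (negPf mw).
Qed.

End TwoEdgeConnected.

(** * Coverable sets and their gluing *)

Section Cubic.
Variables (T : finType) (r : rel T).
Hypotheses (r_sym : symmetric r) (r_irr : irreflexive r).
Hypothesis r_cubic : forall x, #|[set y | r x y]| = 3.
Implicit Types (X Y Z A I : {set T}) (m : T -> T).

Lemma r_neq x y : r x y -> x != y.
Proof. by move=> rxy; apply: contraTneq rxy => ->; rewrite r_irr. Qed.

Lemma third_neighbour x a b : r x a -> r x b -> a != b ->
  exists c, [/\ r x c, c != a, c != b & forall z, r x z -> [|| z == a, z == b | z == c]].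
Proof.
move=> xa xb ab; have sabN : [set a; b] \subset [set y | r x y].
  by rewrite subUset !sub1set !inE xa xb.
have : #|[set y | r x y] :\: [set a; b]| == 1.
  have := cardsID [set a; b] [set y | r x y].
  by rewrite r_cubic (setIidPr sabN) cards2 ab; move: #|_| => [|[|]].
case/cards1P => c defc; have : c \in [set c] by rewrite inE.
rewrite -defc !inE negb_or => /andP[/andP[ca cb] xc].
exists c; split => // z xz; have /setP/(_ z) := defc; rewrite !inE xz andbT negb_or.
by case: (z == a) => //; case: (z == b) => //= ->.
Qed.

Lemma other_neighbour x a : exists2 c, r x c & c != a.
Proof.
have /card_gt0P[c] : 0 < #|[set y | r x y] :\ a|.
  by have := cardsD1 a [set y | r x y]; rewrite r_cubic; case: (a \in _); move: #|_| => [|].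
by rewrite !inE => /andP[ca xc]; exists c.
Qed.

Lemma mates_adj X I m x : mates r X I m -> x \in X -> m x != x -> r x (m x).
Proof. by move=> mP xX /negPf nmx; have [_] := mP x xX; rewrite nmx andbF orbF. Qed.

(** Asking that the neighbours of I lie in X, outside I, makes I stable and keeps
    it away from the edges that leave X, so that unions of such sets I stay
    stable when sets are glued. *)
Definition coverable X : Prop := exists I,
  [/\ I \subset X, {in I, forall x y, r x y -> y \in X :\: I} &
      {in X, forall x y, r x y -> exists2 m, mates r X I m & m x = y}].

(** To use the joining edge, take it as the prescribed edge; to avoid it, prescribe
    another edge at its end vertex in Z. *)
Lemma mates_compatible X Z IX IZ m :
  [disjoint X & Z] -> Z != set0 -> ecount r X Z <= 1 -> mates r X IX m ->
  {in Z, forall z y, r z y -> exists2 m', mates r Z IZ m' & m' z = y} ->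
  exists2 m', mates r Z IZ m' & {in X & Z, forall x z, m x = z <-> m' z = x}.
Proof.
move=> dXZ /set0Pn[z0 z0Z] /ecount_le1P uniqXZ mP throughZ.
have neq x z : x \in X -> z \in Z -> x != z.
  by move=> xX; apply: contraTneq => <-; rewrite (disjointFr dXZ).
have edge x z : x \in X -> z \in Z -> m x = z -> r x z.
  move=> xX zZ mx; rewrite -mx; apply: (mates_adj mP xX).
  by rewrite mx eq_sym neq.
have edge' m' x z : mates r Z IZ m' -> x \in X -> z \in Z -> m' z = x -> r x z.
  move=> m'P xX zZ mz; rewrite -mz r_sym; apply: (mates_adj m'P zZ).
  by rewrite mz neq.
have [/exists_inP[u uX /exists_inP[v vZ ruv]]|/exists_inPn none] :=
  boolP [exists u in X, [exists v in Z, r u v]]; last first.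
  have [y rzy _] := other_neighbour z0 z0.
  have [m' m'P _] := throughZ z0 z0Z y rzy.
  exists m' => // x z xX zZ; have := none x xX => /exists_inPn/(_ z zZ)/negP nrxz.
  by split=> [/(edge x z xX zZ)|/(edge' m' x z m'P xX zZ)].
have [muv|muv] := eqVneq (m u) v.
  have [|m' m'P m'v] := throughZ v vZ u; first by rewrite r_sym.
  exists m' => // x z xX zZ; split=> e.
    by have [-> ->] := uniqXZ x u z v xX uX zZ vZ (edge x z xX zZ e) ruv.
  by have [-> ->] := uniqXZ x u z v xX uX zZ vZ (edge' m' x z m'P xX zZ e) ruv.
have [y rvy yu] := other_neighbour v u; have [m' m'P m'v] := throughZ v vZ y rvy.
exists m' => // x z xX zZ; split=> e.
  have [ex ez] := uniqXZ x u z v xX uX zZ vZ (edge x z xX zZ e) ruv.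
  by rewrite -ex -ez e eqxx in muv.
have [ex ez] := uniqXZ x u z v xX uX zZ vZ (edge' m' x z m'P xX zZ e) ruv.
by move: yu; rewrite -m'v -ez e ex eqxx.
Qed.

Lemma matesU X Z IX IZ m m' :
  [disjoint X & Z] -> mates r X IX m -> mates r Z IZ m' ->
  {in X & Z, forall x z, m x = z <-> m' z = x} ->
  mates r (X :|: Z) (IX :|: IZ) (fun x => if x \in X then m x else m' x).
Proof.
move=> dXZ mP m'P agree x; rewrite inE; case: ifPn => [xX _|xX /= xZ].
  have [mK rm] := mP x xX; split; last first.
    by case/orP: rm => [->//|/andP[xI ->]]; rewrite inE xI orbT.
  rewrite inE; case: ifPn => [mX _|mX /= mZ]; first exact: mK.
  by apply/(agree x (m x)).
have [mK rm] := m'P x xZ; split; last first.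
  by case/orP: rm => [->//|/andP[xI ->]]; rewrite inE xI !orbT.
rewrite inE; case: ifPn => [mX _|mX /= mZ]; last exact: mK.
by apply/(agree (m' x) x).
Qed.

Lemma coverable_glue X Y : Y \subset X -> Y != set0 -> Y != X ->
  ecount r Y (X :\: Y) <= 1 -> coverable Y -> coverable (X :\: Y) -> coverable X.
Proof.
move=> sYX Y0 YX le1 [I [sI indI throughI]] [J [sJ indJ throughJ]].
have dYZ : [disjoint Y & X :\: Y] by rewrite disjoint_sym; apply: disjointDl.
have Z0 : X :\: Y != set0.
  by apply: contraNneq YX => /eqP; rewrite setD_eq0 eqEsubset sYX => ->.
have defX : X = Y :|: (X :\: Y) by rewrite setDE setUIr setUCr setIT (setUidPr sYX).
have IZ x : x \in Y -> x \notin J.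
  by move=> xY; apply: contraL xY => /(subsetP sJ); rewrite inE => /andP[].
have JY x : x \in X :\: Y -> x \notin I.
  by rewrite inE => /andP[xY _]; apply: contra xY => /(subsetP sI).
exists (I :|: J); split.
- by rewrite defX setUSS.
- move=> x; rewrite inE => /orP[xI|xJ] y rxy.
    have := indI x xI y rxy; rewrite inE => /andP[yI yY].
    by rewrite !inE negb_or yI IZ // (subsetP sYX).
  have := indJ x xJ y rxy; rewrite inE => /andP[yJ yZ].
  by rewrite inE in_setU negb_or yJ JY // (subsetP (subsetDl X Y)).
move=> x xX y rxy; have [xY|xY] := boolP (x \in Y).
  have [m mP mx] := throughI x xY y rxy.
  have [m' m'P agree] := mates_compatible dYZ Z0 le1 mP throughJ.
  by rewrite {1}defX; exists (fun z => if z \in Y then m z else m' z); [apply: matesU|rewrite xY].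
have xZ : x \in X :\: Y by rewrite inE xY.
have [m mP mx] := throughJ x xZ y rxy.
rewrite disjoint_sym in dYZ; rewrite ecountC // in le1.
have [m' m'P agree] := mates_compatible dYZ Y0 le1 mP throughI.
rewrite {1}defX setUC (setUC I).
by exists (fun z => if z \in X :\: Y then m z else m' z); [apply: matesU|rewrite xZ].
Qed.

(** * Sets left by a single edge *)

Section SingleExit.
Variable X : {set T}.
Hypothesis no_bridge : forall Y : {set T},
  Y \subset X -> Y != set0 -> Y != X -> 1 < ecount r Y (X :\: Y).

(** A cap A is a part of X that takes over the role of the end vertex of the only
    edge leaving X: this edge starts in A (cap_exit), two edges a1 c1 and a2 c2
    join A to the rest of X, and A has enough perfect matchings using at most one
    of these two, by which one attachment can be freed while the other is used. *)
Record cap A a1 c1 a2 c2 : Prop := Cap {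
  cap_sub : A \subset X;
  cap_a1 : a1 \in A;
  cap_a2 : a2 \in A;
  cap_c1 : c1 \in X :\: A;
  cap_c2 : c2 \in X :\: A;
  cap_e1 : r a1 c1;
  cap_e2 : r a2 c2;
  cap_neq : c1 != c2;
  cap_only : {in A & X :\: A, forall x y, r x y -> x = a1 /\ y = c1 \/ x = a2 /\ y = c2};
  cap_exit : {in X :\: A, forall x y, r x y -> y \in X};
  cap_none : exists2 m, mates r A set0 m & m a1 != c1 /\ m a2 != c2;
  cap_through : {in A, forall x y, r x y ->
    exists2 m, mates r A set0 m & m x = y /\ (m a1 != c1 \/ m a2 != c2)}
}.

Lemma cap_swap A a1 c1 a2 c2 : cap A a1 c1 a2 c2 -> cap A a2 c2 a1 c1.
Proof.
case=> sA a1A a2A c1Z c2Z e1 e2 neq only exit [m mP [n1 n2]] through.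
split => //; first by rewrite eq_sym.
- by move=> x y xA yZ /(only x y xA yZ)[]; [right|left].
- by exists m.
- move=> x xA y rxy; have [m' m'P [m'x n]] := through x xA y rxy.
  by exists m' => //; split=> //; case: n; [right|left].
Qed.

Lemma cap_at_c1 A a1 c1 a2 c2 x :
  cap A a1 c1 a2 c2 -> x \in A -> r x c1 -> x = a1.
Proof.
move=> capA xA rx; have [[]//|[_ e]] := cap_only capA xA (cap_c1 capA) rx.
by have := cap_neq capA; rewrite e eqxx.
Qed.

Lemma cap_rail A a1 c1 a2 c2 : cap A a1 c1 a2 c2 -> r c1 c2 ->
  exists d1, [/\ r c1 d1, d1 \in X :\: A, d1 != c1, d1 != c2 &
    forall z, r c1 z -> [|| z == a1, z == c2 | z == d1]].
Proof.
move=> capA r12; have /setDP[c1X c1A] := cap_c1 capA; have /setDP[c2X c2A] := cap_c2 capA.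
have [||d1 [rd d1a d1c near]] := @third_neighbour c1 a1 c2 _ r12.
- by rewrite r_sym (cap_e1 capA).
- by apply: contraNneq c2A => <-; apply: cap_a1 capA.
exists d1; split=> //; last by rewrite eq_sym r_neq.
rewrite inE (cap_exit capA (cap_c1 capA) rd) andbT.
by apply: contra d1a => d1A; apply/eqP/(cap_at_c1 capA) => //; rewrite r_sym.
Qed.

(** The three equations say that the partners p and q chosen for c1 and c2 respect
    the matching of A and each other. *)
Lemma cap_extend_mates A a1 c1 a2 c2 m p q :
  cap A a1 c1 a2 c2 -> mates r A set0 m -> r c1 p -> r c2 q ->
  (p == a1) = (m a1 == c1) -> (q == a2) = (m a2 == c2) -> (p == c2) = (q == c1) ->
  mates r (A :|: [set c1; c2]) set0
    (fun x => if x == c1 then p else if x == c2 then q else m x).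
Proof.
move=> capA mP rp rq ep eq epq; have capA' := cap_swap capA.
have /setDP[c1X c1A] := cap_c1 capA; have /setDP[c2X c2A] := cap_c2 capA.
have n1 x : x \in A -> (x == c1) = false by move=> xA; apply: contraNF c1A => /eqP <-.
have n2 x : x \in A -> (x == c2) = false by move=> xA; apply: contraNF c2A => /eqP <-.
have c12 := negPf (cap_neq capA); have pc1 : (p == c1) = false by rewrite eq_sym (negPf (r_neq rp)).
have qc2 : (q == c2) = false by rewrite eq_sym (negPf (r_neq rq)).
move=> x; rewrite !inE /= orbF => /orP[xA|/orP[]/eqP->].
- rewrite (n1 x xA) (n2 x xA); have [mK] := mP x xA; rewrite inE /= orbF => rm.
  split=> // /orP[mA|]; first by rewrite n1 // n2 // mK.
  have [e _|_ /= /eqP e] := eqVneq (m x) c1.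
    rewrite e in rm; have ex := cap_at_c1 capA xA rm.
    by apply/eqP; rewrite ex ep -ex e.
  rewrite e eqxx; rewrite e in rm; have ex := cap_at_c1 capA' xA rm.
  by apply/eqP; rewrite ex eq -ex e.
- rewrite eqxx; split=> //; rewrite pc1 /=; case/orP=> [pA|pc2].
    have ea : p = a1 by apply: (cap_at_c1 capA pA); rewrite r_sym.
    by rewrite (n2 p pA); apply/eqP; rewrite ea -ep ea.
  by rewrite pc2; apply/eqP; rewrite -epq.
rewrite eq_sym c12 eqxx; split=> //; rewrite qc2 orbF; case/orP=> [qA|qc1].
  have ea : q = a2 by apply: (cap_at_c1 capA' qA); rewrite r_sym.
  by rewrite (n1 q qA); apply/eqP; rewrite ea -eq ea.
by rewrite qc1; apply/eqP; rewrite epq.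
Qed.

(** When c1 and c2 are adjacent, adding this rung to A gives a cap again.  A
    matching of A using neither attachment is completed by the rung; one using
    a1 c1 is completed by the new attachment at c2, and conversely.  The new
    attachments d1 and d2 differ, since otherwise the third edge at d1 = d2 alone
    would cut off A, the rung and d1. *)
Lemma cap_step A a1 c1 a2 c2 : cap A a1 c1 a2 c2 -> r c1 c2 ->
  exists d1 d2, cap (A :|: [set c1; c2]) c1 d1 c2 d2.
Proof.
move=> capA r12; have capA' := cap_swap capA.
have r21 : r c2 c1 by rewrite r_sym.
have [d1 [rd1 d1Z d1c1 d1c2 near1]] := cap_rail capA r12.
have [d2 [rd2 d2Z d2c2 d2c1 near2]] := cap_rail capA' r21.
have /setDP[c1X c1A] := cap_c1 capA; have /setDP[c2X c2A] := cap_c2 capA.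
have /setDP[d1X d1A] := d1Z; have /setDP[d2X d2A] := d2Z.
have sA := cap_sub capA; have c12 := cap_neq capA.
have a1A := cap_a1 capA; have a2A := cap_a2 capA.
have neqA x y : x \in A -> y \notin A -> x != y by move=> xA; apply: contraNneq => <-.
exists d1, d2; set A' := A :|: _.
have A'P x : x \in A' = [|| x \in A, x == c1 | x == c2] by rewrite !inE.
have sA' : A' \subset X by rewrite !subUset sA !sub1set c1X c2X.
have only x y : x \in A' -> y \in X :\: A' -> r x y -> x = c1 /\ y = d1 \/ x = c2 /\ y = d2.
  rewrite A'P inE A'P !negb_or => /or3P[xA|/eqP->|/eqP->] /andP[/and3P[yA yc1 yc2] yX] rxy.
  - have yZ : y \in X :\: A by rewrite inE yA.
    by case: (cap_only capA xA yZ rxy) => -[_ e]; rewrite e eqxx in yc1 yc2.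
  - have := near1 y rxy; rewrite (negPf yc2) /=.
    by case/orP=> /eqP e; [rewrite e a1A in yA|left].
  have := near2 y rxy; rewrite (negPf yc1) /=.
  by case/orP=> /eqP e; [rewrite e a2A in yA|right].
have d12 : d1 != d2.
  apply/eqP => e; have rd1' : r d1 c1 by rewrite r_sym.
  have rd1'' : r d1 c2 by rewrite e r_sym.
  have [w [rw wc1 wc2 near]] := third_neighbour rd1' rd1'' c12.
  have wX := cap_exit capA d1Z rw.
  have wA : w \notin A.
    apply/negP => wA; have := cap_only capA wA d1Z; rewrite r_sym rw => /(_ isT).
    by case=> -[_ e']; rewrite e' eqxx in d1c1 d1c2.
  have wd : w != d1 by rewrite eq_sym r_neq.
  have w_out : w \notin d1 |: A' by rewrite in_setU1 A'P !negb_or wd wA wc1.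
  have s' : d1 |: A' \subset X by rewrite subUset sub1set d1X.
  have := no_bridge s' _ _; rewrite ltnNge => /(_ _ _)/negP; apply.
  - by apply/set0Pn; exists d1; rewrite !inE eqxx.
  - by apply: contraNneq w_out => ->.
  have toW x y : x \in d1 |: A' -> y \in X :\: (d1 |: A') -> r x y -> x = d1 /\ y = w.
    rewrite in_setU1 => /orP[/eqP->|xA'] /setDP[yX]; rewrite in_setU1 negb_or => /andP[yd yA'] rxy.
      move: yA'; rewrite A'P !negb_or => /and3P[_ yc1 yc2].
      by have := near y rxy; rewrite (negPf yc1) (negPf yc2) => /eqP.
    have yZ : y \in X :\: A' by rewrite inE yA'.
    by case: (only x y xA' yZ rxy) => -[_ ey]; move: yd; rewrite ey ?e eqxx.
  apply/ecount_le1P => x x' y y' xA x'A yA y'A rxy rxy'.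
  by have [-> ->] := toW x y xA yA rxy; have [-> ->] := toW x' y' x'A y'A rxy'.
have rca1 : r c1 a1 by rewrite r_sym (cap_e1 capA).
have rca2 : r c2 a2 by rewrite r_sym (cap_e2 capA).
have c2a1 : (c2 == a1) = false by apply: contraNF c2A => /eqP->.
have c1a2 : (c1 == a2) = false by apply: contraNF c1A => /eqP->.
have a1d1 := negPf (neqA a1 d1 a1A d1A); have a2d2 := negPf (neqA a2 d2 a2A d2A).
have c2d1 : (c2 == d1) = false by rewrite eq_sym (negPf d1c2).
pose ext m p q x := if x == c1 then p else if x == c2 then q else m x : T.
have extA m p q x : x \in A -> ext m p q x = m x.
  by move=> xA; rewrite /ext !(negPf (neqA x _ xA _)).
have ext1 m p q : ext m p q c1 = p by rewrite /ext eqxx.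
have ext2 m p q : ext m p q c2 = q by rewrite /ext eq_sym (negPf c12) eqxx.
have ext_none m : mates r A set0 m -> m a1 != c1 -> m a2 != c2 -> mates r A' set0 (ext m c2 c1).
  by move=> mP /negPf m1 /negPf m2; apply: (cap_extend_mates capA mP); rewrite ?m1 ?m2 ?eqxx.
have ext_e1 m : mates r A set0 m -> m a1 == c1 -> m a2 != c2 -> mates r A' set0 (ext m a1 d2).
  move=> mP m1 /negPf m2; apply: (cap_extend_mates capA mP); rewrite ?m1 ?m2 ?eqxx //.
    by rewrite eq_sym a2d2.
  by rewrite (negPf d2c1) eq_sym c2a1.
have ext_e2 m : mates r A set0 m -> m a1 != c1 -> m a2 == c2 -> mates r A' set0 (ext m d1 a2).
  move=> mP /negPf m1 m2; apply: (cap_extend_mates capA mP); rewrite ?m1 ?m2 ?eqxx //.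
    by rewrite eq_sym a1d1.
  by rewrite (negPf d1c2) eq_sym c1a2.
have [m0 m0P [m01 m02]] := cap_none capA.
have [m1 m1P [/eqP m1c]] := cap_through capA a1A (cap_e1 capA).
rewrite m1c => -[//|m1n]; have [m2 m2P [/eqP m2c]] := cap_through capA a2A (cap_e2 capA).
rewrite m2c => -[m2n|//].
split; rewrite ?A'P ?eqxx ?orbT //.
- by rewrite inE A'P !negb_or d1A d1c1 d1c2.
- by rewrite inE A'P !negb_or d2A d2c1 d2c2.
- by move=> x /setDP[xX]; rewrite A'P negb_or => /andP[xA _]; apply: (cap_exit capA); rewrite inE xA.
- exists (ext m0 c2 c1); first exact: ext_none.
  by rewrite ext1 ext2 c2d1 eq_sym.
move=> x; rewrite A'P => /or3P[xA|/eqP->|/eqP->] y rxy.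
- have [m mP [mx n]] := cap_through capA xA rxy.
  have [e1|e1] := boolP (m a1 == c1).
    have e2 : m a2 != c2 by case: n => //; rewrite e1.
    exists (ext m a1 d2); first exact: ext_e1.
    by rewrite extA // ext1 a1d1; split=> //; left.
  have [e2|e2] := boolP (m a2 == c2).
    exists (ext m d1 a2); first exact: ext_e2.
    by rewrite extA // ext2 a2d2; split=> //; right.
  exists (ext m c2 c1); first exact: ext_none.
  by rewrite extA // ext1 c2d1; split=> //; left.
- have /or3P[/eqP->|/eqP->|/eqP->] := near1 y rxy.
  + exists (ext m1 a1 d2); first exact: ext_e1.
    by rewrite ext1 a1d1; split=> //; left.
  + exists (ext m0 c2 c1); first exact: ext_none.
    by rewrite ext1 c2d1; split=> //; left.
  + exists (ext m2 d1 a2); first exact: ext_e2.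
    by rewrite ext1 ext2; split=> //; right; rewrite a2d2.
- have /or3P[/eqP->|/eqP->|/eqP->] := near2 y rxy.
  + exists (ext m2 d1 a2); first exact: ext_e2.
    by rewrite ext2; split=> //; right; rewrite a2d2.
  + exists (ext m0 c2 c1); first exact: ext_none.
    by rewrite ext2; split=> //; right; rewrite eq_sym.
  + exists (ext m1 a1 d2); first exact: ext_e1.
    by rewrite ext1 ext2; split=> //; left; rewrite a1d1.
Qed.

(** The rest Z of X, with the edge c1 c2 added, is a bridgeless cubic graph; that
    c1 c2 is not an edge yet keeps this graph simple. *)
Section Closing.
Variables (A : {set T}) (a1 c1 a2 c2 : T).
Hypothesis capA : cap A a1 c1 a2 c2.
Hypothesis no_rung : ~~ r c1 c2.
Let Z := X :\: A.

Definition closing : rel T := fun x y =>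
  [|| [&& r x y, x \in Z & y \in Z], (x == c1) && (y == c2) | (x == c2) && (y == c1)].

Lemma closing_sym : symmetric closing.
Proof.
move=> x y; rewrite /closing r_sym [(x == c1) && _]andbC [(x == c2) && _]andbC.
by rewrite [(x \in Z) && _]andbC [(_ == c2) && _ || _]orbC.
Qed.

Lemma closing_irr : irreflexive closing.
Proof.
move=> x; rewrite /closing r_irr; have := cap_neq capA.
by have [->|] := eqVneq x c1; rewrite ?andbF //= => /negPf->.
Qed.

Lemma closing_in x y : closing x y -> x \in Z /\ y \in Z.
Proof.
have [c1Z c2Z] := (cap_c1 capA, cap_c2 capA).
by rewrite /closing => /or3P[/and3P[]|/andP[/eqP-> /eqP->]|/andP[/eqP-> /eqP->]].
Qed.

Lemma closing_r x y : x \in Z -> y \in Z -> r x y -> closing x y.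
Proof. by move=> xZ yZ rxy; rewrite /closing rxy xZ yZ. Qed.

Lemma closing_cubic : {in Z, forall x, #|[set y | closing x y]| = 3}.
Proof.
have [c1Z c2Z] := (cap_c1 capA, cap_c2 capA); have c12 := cap_neq capA.
(* the added edge at an attachment replaces its edge to the cap *)
have at_attachment a c d : a \in A -> r a c -> c \in Z -> ~~ r c d ->
    (forall x, x \in A -> r x c -> x = a) ->
    (forall y, closing c y = (r c y && (y \in Z)) || (y == d)) -> #|[set y | closing c y]| = 3.
  move=> aA rac cZ nrcd only clE.
  have -> : [set y | closing c y] = d |: ([set y | r c y] :\ a).
    apply/setP => y; rewrite !inE clE orbC; have [//|yd /=] := eqVneq y d.
    have [rcy|_] := boolP (r c y); last by rewrite andbF.
    rewrite andbT /= inE (cap_exit capA cZ rcy) andbT.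
    congr negb; apply/idP/eqP => [yA|->//]; by apply: only; rewrite // r_sym.
  rewrite cardsU1 !inE (negPf nrcd) andbF /=.
  by have := cardsD1 a [set y | r c y]; rewrite r_cubic inE r_sym rac => ->.
move=> x xZ; have [->|x1] := eqVneq x c1.
  apply: (at_attachment a1 c1 c2) => //; [exact: cap_a1 capA|exact: cap_e1 capA| |].
    by move=> y yA; apply: cap_at_c1 capA yA.
  by move=> y; rewrite /closing eqxx c1Z (negPf c12) /= orbF.
have [->|x2] := eqVneq x c2.
  apply: (at_attachment a2 c2 c1) => //; [exact: cap_a2 capA|exact: cap_e2 capA|by rewrite r_sym| |].
    by move=> y yA; apply: cap_at_c1 (cap_swap capA) yA.
  by move=> y; rewrite /closing eqxx c2Z eq_sym (negPf c12) /=.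
rewrite -(r_cubic x); apply: eq_card => y; rewrite !inE /closing (negPf x1) (negPf x2) /= orbF xZ /=.
apply: andb_idr => rxy; rewrite inE (cap_exit capA xZ rxy) andbT.
apply/negP => yA; have := cap_only capA yA xZ; rewrite r_sym => /(_ rxy).
by case=> -[_ e]; rewrite e eqxx in x1 x2.
Qed.

(** Cuts are symmetric, so c2 may be assumed outside U.  If c1 is outside too, all
    edges from U to the rest of X stay in Z; if not, only the edge a1 c1 is lost,
    and c1 c2 replaces it. *)
Lemma closing_no_bridge (U : {set T}) :
  U \subset Z -> U != set0 -> U != Z -> 1 < ecount closing U (Z :\: U).
Proof.
wlog c2U : U / c2 \notin U => [wl|].
  have [c2U sU U0 UZ|] := boolP (c2 \in U); last exact: wl.
  have defU : U = Z :\: (Z :\: U) by rewrite setDDr setDv set0U (setIidPr sU).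
  rewrite ecountC; last exact: closing_sym.
  rewrite {2}defU; apply: wl; rewrite ?subsetDl //.
  - by rewrite inE c2U.
  - by apply: contra UZ; rewrite setD_eq0 eqEsubset sU.
  - by apply: contra U0 => /eqP e; rewrite defU e setDv.
move=> sU U0 UZ; have sZX : Z \subset X := subsetDl _ _.
have UX : U != X.
  apply: contraTneq sU => ->; apply/subsetPn; exists a1; last by rewrite inE (cap_a1 capA).
  exact: (subsetP (cap_sub capA) _ (cap_a1 capA)).
have cut := no_bridge (subset_trans sU sZX) U0 UX.
have defXU : X :\: U = (Z :\: U) :|: A.
  apply/setP => y; rewrite in_setU 2!in_setD [y \in Z]in_setD.
  have [yA|yA] := boolP (y \in A); last by rewrite orbF.
  rewrite (subsetP (cap_sub capA) _ yA) orbT andbT.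
  by apply: contraL yA => /(subsetP sU); rewrite inE => /andP[].
have dZA : [disjoint Z :\: U & A].
  exact: disjointWl (subsetDl _ _) (disjointDl _ _).
rewrite defXU ecountUr // in cut.
have le : ecount r U (Z :\: U) <= ecount closing U (Z :\: U).
  apply: leq_sum => x xU; apply: leq_sum => y /setDP[yZ _].
  by have := closing_r (subsetP sU x xU) yZ; case: (r x y) => // ->.
have [c1U|c1U] := boolP (c1 \in U); last first.
  apply: leq_trans cut _; rewrite [X in _ + X]ecount0 ?addn0 // => x y xU yA.
  apply/negP; rewrite r_sym => ryx.
  have := cap_only capA yA (subsetP sU x xU) ryx.
  by case=> -[_ e]; rewrite -e xU in c1U c2U.
have le1 : ecount r U A <= 1.
  have only x y : x \in U -> y \in A -> r x y -> x = c1 /\ y = a1.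
    move=> xU yA; rewrite r_sym => /(cap_only capA yA (subsetP sU x xU)).
    by case=> -[-> e]; rewrite -e ?xU // -e xU in c2U *.
  apply/ecount_le1P => x x' y y' xU x'U yA y'A rxy rxy'.
  by have [-> ->] := only x y xU yA rxy; have [-> ->] := only x' y' x'U y'A rxy'.
rewrite ltnNge; apply/negP => /ecount_le1P uniq.
suff z : ecount r U (Z :\: U) = 0 by move: cut; rewrite z ltnNge le1.
apply: ecount0 => x y xU yZU; apply/negP => rxy; have /setDP[yZ _] := yZU.
have c2ZU : c2 \in Z :\: U by rewrite inE c2U (cap_c2 capA).
have c12 : closing c1 c2 by rewrite /closing !eqxx orbT.
have [ex ey] := uniq _ _ _ _ xU c1U yZU c2ZU (closing_r (subsetP sU x xU) yZ rxy) c12.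
by move: no_rung; rewrite -ex -ey rxy.
Qed.

Lemma closing_through x y : closing x y ->
  exists2 m, mates closing Z set0 m & m x = y.
Proof.
move=> cl; have [xZ yZ] := closing_in cl.
apply: mates_through_edge cl => //.
- exact: closing_sym.
- exact: closing_irr.
- exact: closing_cubic.
- exact: closing_no_bridge.
by rewrite ecount0 // => u v uZ; rewrite inE => vZ; apply: contra vZ => /closing_in[].
Qed.

(** A perfect matching of Z using the added edge leaves c1 and c2 to the cap,
    which may cover them or not; one that avoids it needs a matching of the cap
    that uses neither attachment. *)
Lemma closing_mates mA mZ :
  mates r A set0 mA -> mates closing Z set0 mZ ->
  mZ c1 = c2 \/ mA a1 != c1 /\ mA a2 != c2 ->
  mates r X [set c1; c2]
    (fun x => if x \in A then mA x
              else if (x == c1) && (mZ c1 == c2) then if mA a1 == c1 then a1 else c1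
              else if (x == c2) && (mZ c2 == c1) then if mA a2 == c2 then a2 else c2
              else mZ x).
Proof.
move=> mAP mZP ok; set m := fun x => _.
have capA' := cap_swap capA; have [a1A a2A] := (cap_a1 capA, cap_a2 capA).
have [c1Z c2Z] := (cap_c1 capA, cap_c2 capA); have c12 := negPf (cap_neq capA).
have Zdisj x : x \in Z -> (x \in A) = false by rewrite inE => /andP[/negPf].
have cl x : x \in Z -> closing x (mZ x).
  by move=> xZ; have [_] := mZP x xZ; rewrite inE orbF.
have mZZ x : x \in Z -> mZ x \in Z by move=> /cl/closing_in[].
have mZK x : x \in Z -> mZ (mZ x) = x by move=> xZ; have [+ _] := mZP x xZ; apply; apply: mZZ.
have swap : (mZ c2 == c1) = (mZ c1 == c2) by apply/eqP/eqP => <-; apply: mZK.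
have mA1 : mA a1 == c1 -> mZ c1 = c2 by case: ok => [//|[/negPf->]].
have mA2 : mA a2 == c2 -> mZ c1 = c2 by case: ok => [//|[_ /negPf->]].
have mE1 : mZ c1 = c2 -> m c1 = if mA a1 == c1 then a1 else c1.
  by move=> e; rewrite /m Zdisj // e !eqxx.
have mE2 : mZ c1 = c2 -> m c2 = if mA a2 == c2 then a2 else c2.
  by move=> e; rewrite /m Zdisj // (eq_sym c2) c12 /= swap e !eqxx.
have mEA x : x \in A -> m x = mA x by rewrite /m => ->.
move=> x xX; have [xA|xA] := boolP (x \in A).
  rewrite (mEA x xA); have [mK] := mAP x xA; rewrite inE orbF => rm; rewrite rm; split=> // mX.
  have [mA'|mA'] := boolP (mA x \in A); first by rewrite mEA // mK.
  have mxZ : mA x \in Z by rewrite inE mA'.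
  have [[ex e]|[ex e]] := cap_only capA xA mxZ rm.
    by rewrite e mE1 ?mA1 -?ex ?e ?eqxx.
  by rewrite e mE2 ?mA2 -?ex ?e ?eqxx.
have xZ : x \in Z by rewrite inE xA.
(* f x: the partner of x in mZ is along the added edge *)
pose f x := (mZ c1 == c2) && ((x == c1) || (x == c2)).
have mEZ y : y \in Z -> ~~ f y -> m y = mZ y.
  move=> yZ; rewrite /f /m Zdisj // swap; case: eqP => // _ /=; rewrite ?andbF //.
  by rewrite negb_or => /andP[/negPf-> /negPf->].
have [fx|nfx] := boolP (f x); last first.
  have fmx : ~~ f (mZ x).
    apply: contra nfx => /andP[/eqP e]; rewrite /f e eqxx /= => /orP[]/eqP mx.
      by rewrite -{2}(mZK x xZ) mx e eqxx orbT.
    by rewrite -{1}(mZK x xZ) mx -e mZK // eqxx.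
  rewrite mEZ //; split=> [_|]; first by rewrite mEZ ?mZZ // mZK.
  apply/orP; left; move: (cl x xZ); rewrite /closing.
  case/or3P => [/and3P[]//|/andP[/eqP ex /eqP ey]|/andP[/eqP ex /eqP ey]].
    by move: nfx; rewrite /f -ey ex !eqxx.
  by move: nfx; rewrite /f -swap -ey ex !eqxx orbT.
have /andP[/eqP e /orP[]/eqP->] := fx; [rewrite (mE1 e)|rewrite (mE2 e)].
  have [e1|/negPf n1] := ifPn; last by rewrite (mE1 e) n1 !inE !eqxx /= orbT.
  by rewrite mEA // (eqP e1) r_sym (cap_e1 capA).
have [e2|/negPf n2] := ifPn; last by rewrite (mE2 e) n2 !inE !eqxx /= !orbT.
by rewrite mEA // (eqP e2) r_sym (cap_e2 capA).
Qed.

(** An edge meeting the cap is prescribed in the matching of the cap, combined with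
    a matching of Z through the added edge.  The other edges are prescribed in the
    matching of Z, combined with a matching of the cap using no attachment. *)
Lemma cap_close : coverable X.
Proof.
have [c1Z c2Z] := (cap_c1 capA, cap_c2 capA); have c12 := negPf (cap_neq capA).
have [c1X c1A] := setDP c1Z; have [c2X c2A] := setDP c2Z.
have [a1A a2A] := (cap_a1 capA, cap_a2 capA).
have f12 : closing c1 c2 by rewrite /closing !eqxx orbT.
have [mf mfP mf1] := closing_through f12.
exists [set c1; c2]; split; first by rewrite subUset !sub1set c1X c2X.
  move=> c; rewrite !inE => /orP[]/eqP-> y rcy; rewrite in_setD !inE negb_or.
    rewrite (cap_exit capA c1Z rcy) andbT eq_sym (r_neq rcy) /=.
    by apply: contraNneq no_rung => <-.
  rewrite (cap_exit capA c2Z rcy) andbT [y == c2]eq_sym (r_neq rcy) andbT.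
  by apply: contraNneq no_rung => <-; rewrite r_sym.
have at_A x y : x \in A -> r x y -> exists2 mA, mA x = y & mates r X [set c1; c2]
    (fun z => if z \in A then mA z
              else if (z == c1) && (mf c1 == c2) then if mA a1 == c1 then a1 else c1
              else if (z == c2) && (mf c2 == c1) then if mA a2 == c2 then a2 else c2
              else mf z).
  move=> xA rxy; have [mA mAP [mx _]] := cap_through capA xA rxy.
  by exists mA => //; apply: closing_mates mAP mfP _; left.
have mf2 : mf c2 = c1.
  have [+ _] := mfP c1 c1Z; rewrite mf1; exact.
move=> x xX y rxy; have [xA|xA] := boolP (x \in A).
  have [mA mx mP] := at_A x y xA rxy.
  by eexists; [apply: mP|rewrite /= xA].
have xZ : x \in Z by rewrite inE xA.
have yX := cap_exit capA xZ rxy.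
have [yA|yA] := boolP (y \in A).
  have ryx : r y x by rewrite r_sym.
  have [mA my mP] := at_A y x yA ryx; eexists; first exact: mP.
  rewrite /= (negPf xA) mf1 mf2; move: my.
  have [[-> ->] ->|[-> ->] ->] := cap_only capA yA xZ ryx; first by rewrite !eqxx.
  by rewrite !eqxx (eq_sym c2) c12.
have yZ : y \in Z by rewrite inE yA.
have [m mP mx] := closing_through (closing_r xZ yZ rxy).
have [mA mAP [n1 n2]] := cap_none capA.
eexists; first exact: closing_mates mAP mP (or_intror (conj n1 n2)).
rewrite /= (negPf xA); case: ifP => [/andP[/eqP ex /eqP e]|_].
  by move: rxy; rewrite -mx ex e (negPf no_rung).
case: ifP => [/andP[/eqP ex /eqP e]|//].
by move: rxy; rewrite -mx ex e r_sym (negPf no_rung).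
Qed.

End Closing.

Lemma coverable_cap A a1 c1 a2 c2 : cap A a1 c1 a2 c2 -> coverable X.
Proof.
have [n] := ubnP #|X :\: A|; elim: n A a1 c1 a2 c2 => // n IHn A a1 c1 a2 c2 ltn capA.
have [r12|no_rung] := boolP (r c1 c2); last exact: cap_close capA no_rung.
have [d1 [d2 capA']] := cap_step capA r12.
apply: IHn capA'; rewrite ltnS in ltn; apply: leq_trans ltn; apply: proper_card.
apply: (@sub_proper_trans _ _ ((X :\: A) :\ c1)).
  by rewrite setDDl setDS // setUS // sub1set !inE eqxx.
exact/properD1/(cap_c1 capA).
Qed.

(** The end vertex of the edge that leaves X is a cap by itself. *)
Lemma coverable_single_exit : ecount r X (~: X) = 1 -> coverable X.
Proof.
move=> exit1; have /cards1P[[a o]] : #|[set p : T * T | [&& p.1 \in X, p.2 \in ~: X & r p.1 p.2]]| == 1.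
  by rewrite -ecount_card exit1.
move/setP => exitE; have exitP x y : x \in X -> y \notin X -> r x y -> x = a /\ y = o.
  by move=> xX yX rxy; have := exitE (x, y); rewrite !inE /= xX yX rxy => /esym/eqP[-> ->].
have := exitE (a, o); rewrite !inE /= eqxx => /and3P[aX oX rao].
have [b1 rb1 b1o] := other_neighbour a o.
have [b2 [rb2 b2o b21 near]] := third_neighbour rao rb1 ltac:(by rewrite eq_sym).
have bZ b : r a b -> b != o -> b \in X :\: [set a].
  move=> rb bo; rewrite !inE eq_sym (r_neq rb) /=.
  by apply: contraNT bo => bX; have [_ ->] := exitP a b aX bX rb.
apply: (@coverable_cap [set a] a b1 a b2); split; rewrite ?sub1set ?inE ?eqxx //.
- by have := bZ b1 rb1 b1o; rewrite !inE.
- by have := bZ b2 rb2 b2o; rewrite !inE.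
- by rewrite eq_sym.
- move=> x y /set1P-> /setDP[yX _] ray; case/or3P: (near y ray) => /eqP e; [|by left|by right].
  by rewrite -e yX in oX.
- move=> x /setDP[xX xa] y rxy; apply: contraNT xa => yX.
  by have [-> _] := exitP x y xX yX rxy; rewrite inE.
- exists (fun=> o); last by rewrite !(eq_sym o).
  by move=> _ /set1P->; rewrite inE rao; split=> // /eqP oa; rewrite oa aX in oX.
move=> x /set1P-> y ray; exists (fun=> y).
  by move=> _ /set1P->; rewrite inE ray; split=> // /eqP.
split=> //; have [->|] := eqVneq y b1; [right|left] => //.
by rewrite eq_sym.
Qed.

End SingleExit.

(** * Normality of the line graph *)

(** Cut X along single edges as long as possible. *)
Lemma coverable_cubic X : coverable X.
Proof.
have [n] := ubnP #|X|; elim: n X => // n IHn X; rewrite ltnS => leXn.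
have [/existsP[Y /and4P[sYX Y0 YX le1]]|/existsPn no] := boolP [exists Y : {set T},
   [&& Y \subset X, Y != set0, Y != X & ecount r Y (X :\: Y) <= 1]].
  have ltY : #|Y| < #|X| by apply: proper_card; rewrite properEneq YX.
  have := cardsID Y X; rewrite (setIidPr sYX) => cX.
  apply: coverable_glue le1 _ _ => //; apply: IHn; first exact: leq_trans leXn.
  by apply: leq_trans leXn; rewrite -cX -[X in X < _]add0n ltn_add2r card_gt0.
have no_bridge (Y : {set T}) :
    Y \subset X -> Y != set0 -> Y != X -> 1 < ecount r Y (X :\: Y).
  by move=> sYX Y0 YX; rewrite ltnNge; have := no Y; rewrite sYX Y0 YX.
have [exit1|exit1] := eqVneq (ecount r X (~: X)) 1.
  exact: coverable_single_exit no_bridge exit1.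
exists set0; split=> [|x|x xX y rxy]; [exact: sub0set|by rewrite inE|].
by apply: mates_through_edge rxy.
Qed.

End Cubic.

Lemma mates_line_stable (G : sgraph) (I : {set G}) (m : G -> G) :
  mates (@adj G) [set: G] I m ->
  stable [set e : line_graph G | [exists x, (m x != x) && (val (e : edge G) == [set x; m x])]].
Proof.
move=> mP e f; rewrite !inE => /existsP[x /andP[_ /eqP ex]] /existsP[y /andP[_ /eqP fy]].
have mK z : m (m z) = z by have [->] := mP z (in_setT z).
apply/negP => /andP[neq /set0Pn[z]]; rewrite ex fy => /setIP[zx zy].
case/negP: neq; apply/eqP/val_inj; rewrite ex fy.
have set_mates u : z \in [set u; m u] -> [set u; m u] = [set z; m z].
  by rewrite !inE => /orP[]/eqP->; rewrite // mK setUC.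
by rewrite (set_mates x zx) (set_mates y zy).
Qed.

Theorem theorem1 (G : sgraph) : cubic G -> normal_graph (line_graph G).
Proof.
move=> cubicG.
have [I [_ indI throughI]] :=
  coverable_cubic (@adj_sym G) (@adj_irrefl G) cubicG [set: G].
pose star (x : G) : {set line_graph G} := [set e : line_graph G | x \in val (e : edge G)].
exists [set star x | x in ~: I], [set S : {set line_graph G} | [forall e in S, forall f in S, ~~ adj (s := line_graph G) e f] &&
                                     [forall x in ~: I, star x :&: S != set0]].
split.
- apply/setP => e; rewrite in_setT; apply/bigcupP.
  have /existsP[x /existsP[y /andP[rxy /eqP ex]]] := valP e.
  have [xI|xI] := boolP (x \in I); last first.
    by exists (star x); [apply: imset_f; rewrite inE|rewrite inE ex !inE eqxx].
  have /setDP[_ yI] := indI x xI y rxy.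
  by exists (star y); [apply: imset_f; rewrite inE|rewrite inE ex !inE eqxx orbT].
- apply/setP => e; rewrite in_setT; apply/bigcupP.
  have /existsP[x /existsP[y /andP[rxy /eqP ex]]] := valP e.
  have [m mP mx] := throughI x (in_setT x) y rxy.
  exists [set e : line_graph G | [exists x, (m x != x) && (val (e : edge G) == [set x; m x])]].
    rewrite inE; apply/andP; split.
      apply/forall_inP => f fS; apply/forall_inP => g gS.
      exact: mates_line_stable mP _ _ fS gS.
    apply/forall_inP => z; rewrite inE => zI.
    have [_] := mP z (in_setT z); rewrite (negPf zI) orbF => rz.
    have edge_z : is_edge [set z; m z].
      by apply/existsP; exists z; apply/existsP; exists (m z); rewrite rz eqxx.
    apply/set0Pn; exists (exist (@is_edge G) _ edge_z); rewrite !inE eqxx /=.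
    apply/existsP; exists z; rewrite eqxx andbT.
    by apply: contraTneq rz => ->; rewrite adj_irrefl.
  rewrite inE; apply/existsP; exists x; rewrite mx ex eqxx andbT.
  by apply: contraTneq rxy => ->; rewrite adj_irrefl.
- move=> _ /imsetP[x _ ->] e f; rewrite !inE => xe xf ef.
  by apply/andP; split=> //; apply/set0Pn; exists x; rewrite inE xe.
- move=> S; rewrite inE => /andP[/forall_inP stS _] e f eS fS.
  exact: (forall_inP (stS e eS)).
move=> _ S /imsetP[x xI ->]; rewrite inE => /andP[_ /forall_inP meet].
exact: meet.
Qed.
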